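(* Let $A_t$ be a smooth family of positive-definite inner products on a finite-dimensional real vector space $Z$ over a compact interval $I$, and let $f\in L^1(I)$ be nonnegative with $\int_If>0$. For $q\in Z$ define $$k(q;f,A)=\sup_{0\ne\lambda\in Z^*}\frac{|\lambda(q)|}{\int_If(t)\sqrt{A_t^{-1}(\lambda,\lambda)}\,\mathrm dt}.$$ For $k\ge0$ there exists a measurable $c:I\to Z$ satisfying $$\int_Ic(t)\,\mathrm dt=q,\qquad|c(t)|_{A_t}\le kf(t)\quad\text{almost everywhere}$$ if and only if $k\ge k(q;f,A)$. Whenever the condition holds, one may choose $c(t)=f(t)d(t)$ with $d$ smooth on $I$ and $|d(t)|_{A_t}\le k$. Thus, for each fixed triple $(q,f,A)$, the infimum over admissible uniform bounds $k$ is attained.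
   Context: $A_t^{-1}$ is the dual quadratic form on $Z^*$; $|z|_{A_t}=\sqrt{A_t(z,z)}$. *)

(* Defs.v *)
From HB Require Import structures.
From mathcomp Require Import all_boot all_order all_algebra.
From mathcomp Require Import all_classical all_reals all_analysis.

Set Implicit Arguments.
Unset Strict Implicit.
Unset Printing Implicit Defensive.

Import Order.TTheory GRing.Theory Num.Theory.
Import numFieldNormedType.Exports.

Local Open Scope classical_set_scope.
Local Open Scope ring_scope.

(* C^oo on a set that need not be open (here a compact interval): restriction
   of a function that is C^oo on some open neighbourhood of the set. *)
Definition smooth_on (R : realType) (D : set R) (h : R -> R) : Prop :=
  exists (U : set R) (g : R -> R),
    [/\ open U, D `<=` U,
        (forall (n : nat) (x : R), U x -> derivable (derive1n n g) x 1)
      & (forall x, D x -> h x = g x)].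

Section InnerProducts.
Variables (R : realType) (Z : vectType R).

Definition inner_product (B : Z -> Z -> R) : Prop :=
  [/\ (forall v, scalar (B^~ v)), (forall u, scalar (B u)),
      (forall u v, B u v = B v u) & (forall u, u != 0 -> 0 < B u u)].

Definition dual : vectType R := 'Hom(Z, R^o).

(* For B bilinear, the map z |-> B(z, .) from Z to its dual; an isomorphism
   when B is an inner product. *)
Definition flat (B : Z -> Z -> R) : 'Hom(Z, dual) :=
  linfun (fun z : Z => linfun (fun w : Z => B z w : R^o) : dual).

(* B^{-1}(lambda, mu) = lambda(B^{-1} mu), with B seen as the map flat B. *)
Definition dual_form (B : Z -> Z -> R) (lambda mu : 'Hom(Z, R^o)) : R :=
  lambda ((flat B)^-1%VF mu).

Definition form_norm (B : Z -> Z -> R) (z : Z) : R := Num.sqrt (B z z).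

Definition smooth_family (D : set R) (A : R -> Z -> Z -> R) : Prop :=
  forall u v : Z, smooth_on D (fun t => A t u v).

End InnerProducts.

(* A general vectType carries no topology or sigma-algebra: regularity and
   integration of Z-valued maps are taken coordinatewise. *)
Section VectorValued.
Variables (R : realType) (Z : vectType R).
Local Notation mu := (@lebesgue_measure R).

Definition vcoord (i : 'I_(\dim {:Z})) (z : Z) : R :=
  coord (vbasis {:Z}) i z.

Definition vsmooth_on (D : set R) (d : R -> Z) : Prop :=
  forall i, smooth_on D (fun t => vcoord i (d t)).

Definition vmeasurable (D : set R) (c : R -> Z) : Prop :=
  forall i, measurable_fun D (fun t => vcoord i (c t)).

Definition vintegrable (D : set R) (c : R -> Z) : Prop :=
  forall i, mu.-integrable D (fun t => (vcoord i (c t))%:E).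

Definition vintegral (D : set R) (c : R -> Z) : Z :=
  \sum_(i < \dim {:Z})
    (\int[mu]_(t in D) vcoord i (c t)) *: (vbasis {:Z})`_i.

End VectorValued.

Section Control.
Variables (R : realType) (Z : vectType R).
Local Notation mu := (@lebesgue_measure R).

(* k(q; f, A), as an extended real (it is -oo when Z = 0, the supremum then
   being over the empty set). *)
Definition kconst (D : set R) (q : Z) (f : R -> R) (A : R -> Z -> Z -> R) :
    \bar R :=
  ereal_sup
    [set (`|lambda q| /
           \int[mu]_(t in D) (f t * Num.sqrt (dual_form (A t) lambda lambda)))%:E
    | lambda in [set lambda : 'Hom(Z, R^o) | lambda != 0]].

Definition control (D : set R) (q : Z) (f : R -> R) (A : R -> Z -> Z -> R)
    (k : R) (c : R -> Z) : Prop :=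
  [/\ vmeasurable D c, vintegrable D c, vintegral D c = q
    & {ae mu, forall t, D t -> form_norm (A t) (c t) <= k * f t}].

Definition admissible_bounds (D : set R) (q : Z) (f : R -> R)
    (A : R -> Z -> Z -> R) : set R :=
  [set k | 0 <= k /\ exists c : R -> Z, control D q f A k c].

End Control.

(* Main.v *)
(* Let [N la] be the integral of [f t * |la|_t], where [|.|_t] is the norm dual
   to [A t]. Necessity of [k >= k(q; f, A)] is Cauchy-Schwarz under the
   integral. Conversely, by compactness some [la0 != 0] maximizes
   [la q / N la]; let [k0] be the maximum. The function [la |-> k0 * N la - la q] is minimal at [la0],
   and its stationarity there says exactly that
   [d t = k0 * (A t)^-1 la0 / |la0|_t], which is smooth of constant length [k0],
   satisfies [\int f d = q]. Only a one-sided quadratic bound on [N] at [la0]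
   is needed, so no differentiation under the integral takes place. *)
Require Import Defs.
From HB Require Import structures.
From mathcomp Require Import all_boot all_order all_algebra.
From mathcomp Require Import all_classical all_reals all_analysis.
From mathcomp Require Import measurable_realfun ring lra.

Set Implicit Arguments.
Unset Strict Implicit.
Unset Printing Implicit Defensive.

Import Order.TTheory GRing.Theory Num.Theory.
Import numFieldNormedType.Exports.

Local Open Scope classical_set_scope.
Local Open Scope ring_scope.

(** * Calculus of smooth functions on a set *)

Section SmoothOn.
Variable R : realType.
Implicit Types (D U V : set R) (f g h : R -> R) (n : nat).

(** Finite-order differentiability, with the derivative taken on the inside: an induction on [n]
    then applies directly to [derive1 g], which suits the Leibniz and chain rules better than
    [derive1n]. *)
Fixpoint diff_upto n U g : Prop :=
  if n is m.+1 then
    (forall x, U x -> derivable g x 1) /\ diff_upto m U (derive1 g)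
  else True.

Lemma diff_uptoP U g :
  (forall n, diff_upto n U g) <->
  (forall n x, U x -> derivable (derive1n n g) x 1).
Proof.
split=> [H n|H n].
  by elim: n g H => [|n IH] g H; [case: (H 1%N)|
    rewrite derive1Sn; apply: IH => n0; case: (H n0.+1)].
elim: n g H => [//|n IH] g H; split; first exact: (H 0%N).
by apply: IH => m; rewrite -derive1Sn; exact: H.
Qed.

Lemma diff_uptoW n U g : diff_upto n.+1 U g -> diff_upto n U g.
Proof.
elim: n g => [//|n IH] g [dg hg]; split; first exact: dg.
exact: IH.
Qed.

Lemma diff_upto_sub n U V g : U `<=` V -> diff_upto n V g -> diff_upto n U g.
Proof.
move=> UV; elim: n g => [//|n IH] g [dg hg]; split; last exact: IH.
by move=> x /UV; exact: dg.
Qed.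

Lemma near_open_eq U f g x : open U -> (forall y, U y -> f y = g y) -> U x ->
  {near x, f =1 g}.
Proof.
by move=> oU fg Ux; apply: filterS (open_nbhs_nbhs (conj oU Ux)) => y /fg.
Qed.

(** Since [U] is open, agreement on [U] is agreement near each of its points, so it passes to the
    derivatives. This is how each derivative below is replaced by its explicit formula. *)
Lemma diff_upto_ext n U f g : open U -> (forall x, U x -> f x = g x) ->
  diff_upto n U f -> diff_upto n U g.
Proof.
move=> oU; elim: n f g => [//|n IH] f g fg [df hf]; split.
  by move=> x Ux; apply: near_eq_derivable (df x Ux); exact: near_open_eq Ux.
apply: IH hf => x Ux; rewrite !derive1E; apply: near_eq_derive.
exact: (near_open_eq oU fg Ux).
Qed.

Lemma diff_upto_cst n U (c : R) : diff_upto n U (fun=> c).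
Proof.
elim: n c => [//|n IH] c; split; first by move=> x _; exact: derivable_cst.
rewrite (_ : derive1 _ = fun=> 0) //; apply/funext => x.
by rewrite derive1_cst.
Qed.

Lemma diff_uptoD n U f g : open U -> diff_upto n U f -> diff_upto n U g ->
  diff_upto n U (fun x => f x + g x).
Proof.
move=> oU; elim: n f g => [//|n IH] f g [df hf] [dg hg]; split.
  by move=> x Ux; apply: derivableD; [exact: df|exact: dg].
apply: diff_upto_ext (IH _ _ hf hg) => // x Ux.
rewrite !derive1E; apply/esym; exact: (deriveD (df x Ux) (dg x Ux)).
Qed.

Lemma diff_uptoM n U f g : open U -> diff_upto n U f -> diff_upto n U g ->
  diff_upto n U (fun x => f x * g x).
Proof.
move=> oU; elim: n f g => [//|n IH] f g Hf Hg.
have [df hf] := Hf; have [dg hg] := Hg; split.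
  by move=> x Ux; apply: derivableM; [exact: df|exact: dg].
have H := diff_uptoD oU (IH _ _ (diff_uptoW Hf) hg) (IH _ _ (diff_uptoW Hg) hf).
apply: diff_upto_ext H => // x Ux.
rewrite !derive1E; apply/esym; exact: (deriveM (df x Ux) (dg x Ux)).
Qed.

(** The derivative $-f'/f^2$ is a product of [f^-1] with itself and [f']; the induction hypothesis
    at one order less controls the factors [f^-1]. *)
Lemma diff_uptoV n U f : open U -> (forall x, U x -> f x != 0) ->
  diff_upto n U f -> diff_upto n U (fun x => (f x)^-1).
Proof.
move=> oU f0; elim: n => [//|n IH] Hf; have [df hf] := Hf; split.
  by move=> x Ux; apply: derivableV; [exact: f0|exact: df].
have Hi := IH (diff_uptoW Hf).
have H := diff_uptoM oU (diff_upto_cst n U (-1))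
            (diff_uptoM oU (diff_uptoM oU Hi Hi) hf).
apply: diff_upto_ext H => // x Ux.
rewrite !derive1E deriveV; [|exact: f0|exact: df].
by rewrite /GRing.scale/= mulN1r mulNr -expr2 exprVn.
Qed.

Lemma is_derive_sqrt_comp f x : 0 < f x -> derivable f x 1 ->
  is_derive x 1 (fun y => Num.sqrt (f y))
    ((2 * Num.sqrt (f x))^-1 * derive1 f x).
Proof.
move=> f0 df.
have H1 : is_derive x 1 f (derive1 f x) by rewrite derive1E; exact/derivableP.
have H2 := is_derive1_sqrt f0.
by have := is_derive1_comp H2 H1; rewrite mulrC.
Qed.

(** The derivative is $f'/(2\sqrt f)$, where $\sqrt f$ occurs again at one order less. *)
Lemma diff_upto_sqrt n U f : open U -> (forall x, U x -> 0 < f x) ->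
  diff_upto n U f -> diff_upto n U (fun x => Num.sqrt (f x)).
Proof.
move=> oU f0; elim: n => [//|n IH] Hf; have [df hf] := Hf.
have D x (Ux : U x) := is_derive_sqrt_comp (f0 x Ux) (df x Ux).
split; first by move=> x /D [].
have H2 : diff_upto n U (fun x => (2 * Num.sqrt (f x))^-1).
  apply: diff_uptoV => //.
    by move=> x Ux; rewrite mulf_neq0// gt_eqF// sqrtr_gt0 f0.
  by apply: diff_uptoM => //; [exact: diff_upto_cst|exact/IH/diff_uptoW].
apply: diff_upto_ext (diff_uptoM oU H2 hf) => // x Ux.
by rewrite [RHS]derive1E; case: (D x Ux) => _ ->.
Qed.

Lemma smooth_onP D h : smooth_on D h <->
  exists U g, [/\ open U, D `<=` U, (forall n, diff_upto n U g)
                & (forall x, D x -> h x = g x)].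
Proof.
by split=> -[U [g [oU DU Hg hg]]]; exists U, g; split=> //; apply/diff_uptoP.
Qed.

Lemma diff_upto_continuous U g x : diff_upto 1 U g -> U x ->
  {for x, continuous g}.
Proof.
by case=> dg _ Ux; apply/differentiable_continuous/derivable1_diffP/dg.
Qed.

Lemma open_setI_preimage U V g : open U -> diff_upto 1 U g -> open V ->
  open (U `&` g @^-1` V).
Proof.
move=> oU dg oV; rewrite openE => x [Ux Vx]; apply: filterI.
  exact: (open_nbhs_nbhs (conj oU Ux)).
exact: (diff_upto_continuous dg Ux) (open_nbhs_nbhs (conj oV Vx)).
Qed.

Lemma smooth_on_ext D f g : (forall x, D x -> f x = g x) ->
  smooth_on D f -> smooth_on D g.
Proof.
move=> fg [U [h [oU DU dh fh]]]; exists U, h; split=> // x Dx.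
by rewrite -fg// fh.
Qed.

Lemma smooth_on_cst D (c : R) : smooth_on D (fun=> c).
Proof.
apply/smooth_onP; exists setT, (fun=> c); split=> //; first exact: openT.
by move=> n; exact: diff_upto_cst.
Qed.

Lemma smooth_onD D f g : smooth_on D f -> smooth_on D g ->
  smooth_on D (fun x => f x + g x).
Proof.
move=> /smooth_onP[U [f' [oU DU df ff']]] /smooth_onP[V [g' [oV DV dg gg']]].
apply/smooth_onP; exists (U `&` V), (fun x => f' x + g' x); split.
- exact: openI.
- by move=> x Dx; split; [exact: DU|exact: DV].
- move=> n; apply: diff_uptoD; first exact: openI.
    by apply: (diff_upto_sub _ (df n)); exact: subIsetl.
  by apply: (diff_upto_sub _ (dg n)); exact: subIsetr.
- by move=> x Dx; rewrite ff'// gg'.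
Qed.

Lemma smooth_onM D f g : smooth_on D f -> smooth_on D g ->
  smooth_on D (fun x => f x * g x).
Proof.
move=> /smooth_onP[U [f' [oU DU df ff']]] /smooth_onP[V [g' [oV DV dg gg']]].
apply/smooth_onP; exists (U `&` V), (fun x => f' x * g' x); split.
- exact: openI.
- by move=> x Dx; split; [exact: DU|exact: DV].
- move=> n; apply: diff_uptoM; first exact: openI.
    by apply: (diff_upto_sub _ (df n)); exact: subIsetl.
  by apply: (diff_upto_sub _ (dg n)); exact: subIsetr.
- by move=> x Dx; rewrite ff'// gg'.
Qed.

(** The smooth extension of [f] may vanish off [D], so its domain is first cut down to the open set
    where it is nonzero. The square root is treated in the same way, with positivity. *)
Lemma smooth_onV D f : (forall x, D x -> f x != 0) -> smooth_on D f ->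
  smooth_on D (fun x => (f x)^-1).
Proof.
move=> f0 /smooth_onP[U [g [oU DU dg fg]]].
have oV := open_setI_preimage oU (dg 1%N) (@open_neq R 0).
apply/smooth_onP; exists (U `&` g @^-1` [set y | y != 0]), (fun x => (g x)^-1).
split=> //.
- by move=> x Dx; split; [exact: DU|rewrite /= -fg// f0].
- move=> n; apply: diff_uptoV => //; first by move=> x [].
  by apply: (diff_upto_sub _ (dg n)); exact: subIsetl.
- by move=> x Dx; rewrite fg.
Qed.

Lemma smooth_on_sqrt D f : (forall x, D x -> 0 < f x) -> smooth_on D f ->
  smooth_on D (fun x => Num.sqrt (f x)).
Proof.
move=> f0 /smooth_onP[U [g [oU DU dg fg]]].
have oV := open_setI_preimage oU (dg 1%N) (@open_gt R 0).
apply/smooth_onP.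
exists (U `&` g @^-1` [set y | 0 < y]), (fun x => Num.sqrt (g x)).
split=> //.
- by move=> x Dx; split; [exact: DU|rewrite /= -fg// f0].
- move=> n; apply: diff_upto_sqrt => //; first by move=> x [].
  by apply: (diff_upto_sub _ (dg n)); exact: subIsetl.
- by move=> x Dx; rewrite fg.
Qed.

Lemma smooth_on_sum D (I : Type) (r : seq I) (P : pred I) (F : I -> R -> R) :
  (forall i, smooth_on D (F i)) ->
  smooth_on D (fun x => \sum_(i <- r | P i) F i x).
Proof.
move=> H; elim: r => [|i r IH].
  by apply: smooth_on_ext (smooth_on_cst D 0) => x _; rewrite big_nil.
case: (boolP (P i)) => Pi; last first.
  by apply: smooth_on_ext IH => x _; rewrite big_cons (negbTE Pi).
by apply: smooth_on_ext (smooth_onD (H i) IH) => x _; rewrite big_cons Pi.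
Qed.

Lemma smooth_on_prod D (I : Type) (r : seq I) (P : pred I) (F : I -> R -> R) :
  (forall i, smooth_on D (F i)) ->
  smooth_on D (fun x => \prod_(i <- r | P i) F i x).
Proof.
move=> H; elim: r => [|i r IH].
  by apply: smooth_on_ext (smooth_on_cst D 1) => x _; rewrite big_nil.
case: (boolP (P i)) => Pi; last first.
  by apply: smooth_on_ext IH => x _; rewrite big_cons (negbTE Pi).
by apply: smooth_on_ext (smooth_onM (H i) IH) => x _; rewrite big_cons Pi.
Qed.

Lemma smooth_on_det D m (G : R -> 'M[R]_m) :
  (forall i j, smooth_on D (fun t => G t i j)) ->
  smooth_on D (fun t => \det (G t)).
Proof.
move=> H; rewrite /determinant; apply: smooth_on_sum => s.
by apply: smooth_onM; [exact: smooth_on_cst|exact: smooth_on_prod].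
Qed.

Lemma smooth_on_adj D m (G : R -> 'M[R]_m) i j :
  (forall i j, smooth_on D (fun t => G t i j)) ->
  smooth_on D (fun t => \adj (G t) i j).
Proof.
move=> H.
have H1 : smooth_on D (fun t => (-1) ^+ (j + i) * \det (row' j (col' i (G t)))).
  apply: smooth_onM; first exact: smooth_on_cst.
  apply: smooth_on_det => i' j'.
  by apply: smooth_on_ext (H (lift j i') (lift i j')) => x _; rewrite !mxE.
by apply: smooth_on_ext H1 => x _; rewrite mxE.
Qed.

(** Cramer's rule: the determinant and the adjugate are polynomial in the entries, and the
    determinant does not vanish on [D]. *)
Lemma smooth_on_invmx D m (G : R -> 'M[R]_m) i j :
  (forall t, D t -> G t \in unitmx) ->
  (forall i j, smooth_on D (fun t => G t i j)) ->
  smooth_on D (fun t => invmx (G t) i j).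
Proof.
move=> uG H.
have H1 : smooth_on D (fun t => (\det (G t))^-1 * \adj (G t) i j).
  apply: smooth_onM; last exact: smooth_on_adj.
  apply: smooth_onV; last exact: smooth_on_det.
  by move=> x Dx; rewrite -unitfE -unitmxE uG.
by apply: smooth_on_ext H1 => x Dx; rewrite /invmx uG// [in RHS]mxE.
Qed.

Lemma smooth_on_continuous D h : smooth_on D h -> {within D, continuous h}.
Proof.
move=> /smooth_onP[U [g [oU DU dg hg]]].
apply: (@subspace_eq_continuous _ _ _ g).
  by move=> x; rewrite inE => /hg.
apply: continuous_in_subspaceT => x; rewrite inE => Dx.
exact: diff_upto_continuous (dg 1%N) (DU x Dx).
Qed.

End SmoothOn.

(** * Inner products, Riesz representatives and the dual norm *)

Section InnerProductTheory.
Variables (R : realType) (Z : vectType R) (B : Z -> Z -> R).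
Hypothesis hB : inner_product B.
Implicit Types (u v z : Z) (la mu : 'Hom(Z, R^o)).

Lemma ipDl u v z : B (u + v) z = B u z + B v z.
Proof. by have [/(_ z 1 u v) + _ _ _] := hB; rewrite /= scale1r mul1r. Qed.

Lemma ipC u v : B u v = B v u.
Proof. by have [_ _ + _] := hB. Qed.

Lemma ip0l z : B 0 z = 0.
Proof. by apply: (addrI (B 0 z)); rewrite -ipDl !addr0. Qed.

Lemma ipZl c u z : B (c *: u) z = c * B u z.
Proof.
by have [/(_ z c u 0) + _ _ _] := hB; rewrite /= addr0 ip0l addr0.
Qed.

Lemma ipDr u v z : B z (u + v) = B z u + B z v.
Proof. by rewrite ipC ipDl !(ipC z). Qed.

Lemma ipZr c u z : B z (c *: u) = c * B z u.
Proof. by rewrite ipC ipZl ipC. Qed.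

Lemma ip_gt0 u : u != 0 -> 0 < B u u.
Proof. by have [_ _ _ +] := hB; exact. Qed.

Lemma ip_ge0 u : 0 <= B u u.
Proof. by have [->|/ip_gt0/ltW//] := eqVneq u 0; rewrite ip0l. Qed.

Lemma ip_sqr_le u v : B u v ^+ 2 <= B u u * B v v.
Proof.
have [->|v0] := eqVneq v 0; first by rewrite ipC !ip0l expr0n mulr0.
have Bv := ip_gt0 v0.
(* The form at this vector equals $B(v,v)\,(B(u,u)B(v,v)-B(u,v)^2)$, and the first factor is
   positive. *)
have := ip_ge0 (B v v *: u + (- B u v) *: v).
rewrite !(ipDl, ipDr, ipZl, ipZr) (ipC v u) => H.
rewrite -(ler_pM2l Bv); nra.
Qed.

Lemma ip_norm_le u v : `|B u v| <= form_norm B u * form_norm B v.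
Proof.
by rewrite /form_norm -sqrtrM ?ip_ge0// -sqrtr_sqr ler_wsqrtr// ip_sqr_le.
Qed.

Lemma form_norm_sqr u : form_norm B u ^+ 2 = B u u.
Proof. by rewrite sqr_sqrtr// ip_ge0. Qed.

Lemma form_normZ c u : form_norm B (c *: u) = `|c| * form_norm B u.
Proof.
by rewrite /form_norm ipZl ipZr mulrA -expr2 sqrtrM ?sqr_ge0// sqrtr_sqr.
Qed.

Lemma form_normD u v : form_norm B (u + v) <= form_norm B u + form_norm B v.
Proof.
have fu : 0 <= form_norm B u by exact: sqrtr_ge0.
have fv : 0 <= form_norm B v by exact: sqrtr_ge0.
rewrite -(@ler_pXn2r _ 2)// ?nnegrE ?addr_ge0 ?sqrtr_ge0//.
rewrite form_norm_sqr !(ipDl, ipDr) (ipC v u).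
have := ler_norm (B u v); have := ip_norm_le u v.
have := form_norm_sqr u; have := form_norm_sqr v; nra.
Qed.

Lemma form_norm_gt0 u : u != 0 -> 0 < form_norm B u.
Proof. by move=> /ip_gt0; rewrite sqrtr_gt0. Qed.

(* The square root lies below its tangent. *)
Lemma form_norm_tangent u v s : u != 0 ->
  form_norm B (u + s *: v) <=
  form_norm B u + s * (B u v / form_norm B u)
    + s ^+ 2 * (B v v / (2 * form_norm B u)).
Proof.
move=> /form_norm_gt0; set x := form_norm B u => x0.
set y := form_norm _ _; have y0 : 0 <= y by exact: sqrtr_ge0.
have hy : y ^+ 2 = x ^+ 2 + 2 * s * B u v + s ^+ 2 * B v v.
  rewrite !form_norm_sqr !(ipDl, ipDr, ipZl, ipZr) (ipC v u).
  by rewrite mulrA -expr2; ring.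
(* In this shape the claim is $y\le(x^2+y^2)/(2x)$, that is, $(x-y)^2\ge0$. *)
have -> : x + s * (B u v / x) + s ^+ 2 * (B v v / (2 * x)) =
          (x ^+ 2 + y ^+ 2) / (2 * x).
  by rewrite hy; field; rewrite gt_eqF.
rewrite ler_pdivlMr ?mulr_gt0//; have := sqr_ge0 (x - y); nra.
Qed.

(** [lfunE] evaluates [linfun] only on maps with a linear structure, so bilinearity of [B] is packed
    into such structures for the inner and then the outer map. *)
Lemma flatE u v : (flat B u : 'Hom(Z, R^o)) v = B u v.
Proof.
have [H1 H2 _ _] := hB.
pose L1 z := HB.pack_for {linear Z -> R^o} (fun w : Z => B z w : R^o)
  (GRing.isLinear.Build R Z R^o _ (fun w : Z => B z w : R^o) (H2 z)).
have L1E z w : linfun (fun w : Z => B z w : R^o) w = B z w.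
  exact: (lfunE (L1 z)).
have L2 : linear (fun z : Z => linfun (fun w : Z => B z w : R^o) : dual Z).
  move=> c z1 z2; apply/lfunP => w.
  by rewrite add_lfunE scale_lfunE !L1E ipDl ipZl.
pose L3 := HB.pack_for {linear Z -> dual Z}
  (fun z : Z => linfun (fun w : Z => B z w : R^o) : dual Z)
  (GRing.isLinear.Build R Z (dual Z) _ _ L2).
by rewrite /flat (lfunE L3) L1E.
Qed.

(** The Riesz representative of [la]. It turns dual norms into norms of vectors of [Z], to which
    Cauchy-Schwarz and the triangle inequality apply. *)
Definition sharp la : Z := (flat B)^-1%VF la.

(** Positivity makes [flat B] injective; as [Z] and its dual have equal dimensions it is onto, so
    the generic inverse [^-1%VF] is a genuine right inverse. *)
Lemma sharpE la v : B (sharp la) v = la v.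
Proof.
have ker0 : lker (flat B) = 0%VS.
  apply/eqP; rewrite -subv0; apply/subvP => z; rewrite memv_ker => /eqP fz.
  rewrite memv0; apply: contraT => /ip_gt0; rewrite -flatE fz zero_lfunE.
  by rewrite ltxx.
have fE : limg (flat B) = fullv.
  apply/eqP; rewrite -(dimv_leqif_eq (subvf _)).
  rewrite limg_dim_eq ?ker0 ?capv0// !dimvf; apply/eqP.
  by rewrite -[LHS]muln1.
by rewrite -flatE /sharp limg_lfunVK// fE memvf.
Qed.

(** The difference of two representatives is orthogonal to every vector, itself included. Linearity
    of [sharp] follows from this uniqueness. *)
Lemma sharp_eq u la : (forall v, B u v = la v) -> sharp la = u.
Proof.
move=> H; apply/eqP; rewrite -subr_eq0; apply: contraT => /ip_gt0.
by rewrite ipDl -scaleN1r ipZl sharpE H mulN1r subrr ltxx.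
Qed.

Lemma sharpD la mu : sharp (la + mu) = sharp la + sharp mu.
Proof. by apply: sharp_eq => v; rewrite ipDl !sharpE add_lfunE. Qed.

Lemma sharpZ c la : sharp (c *: la) = c *: sharp la.
Proof. by apply: sharp_eq => v; rewrite ipZl !sharpE scale_lfunE. Qed.

Lemma sharp_neq0 la : la != 0 -> sharp la != 0.
Proof.
apply: contra_neq => s0; apply/lfunP => v.
by rewrite -sharpE s0 ip0l zero_lfunE.
Qed.

Lemma dual_formE la mu : dual_form B la mu = B (sharp la) (sharp mu).
Proof. by rewrite sharpE. Qed.

Lemma sqrt_dual_form la :
  Num.sqrt (dual_form B la la) = form_norm B (sharp la).
Proof. by rewrite dual_formE. Qed.

End InnerProductTheory.

(** * Maximizing a linear form against a norm in finite dimension *)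

Section RatioMax.
Variables (R : realType).

Lemma lipschitz_continuous_rV m (F : 'rV[R]_m -> R) (C : R) :
  (forall x y, `|F x - F y| <= C * `|x - y|) -> continuous F.
Proof.
(* [C] has no assumed sign; [|C| + 1] is a positive constant that still works. *)
move=> FC x; have C0 : 0 < `|C| + 1 by rewrite ltr_pwDr.
apply/(@cvgrPdist_lt _ _ _ (nbhs x)) => e e0; near=> y.
apply: le_lt_trans (FC x y) _.
apply: (@le_lt_trans _ _ ((`|C| + 1) * `|x - y|)).
  by rewrite ler_wpM2r// ler_wpDr// ler_norm.
rewrite mulrC -ltr_pdivlMr//; near: y.
have := @near_ball _ _ x _ (divr_gt0 e0 C0).
by apply: filterS => z; rewrite -ball_normE.
Unshelve. all: by end_near. Qed.

Variables (T : vectType R).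
Let e := vbasis {:T}.
(** Coordinates transport the problem to row vectors, where a topology and compactness are
    available. *)
Let g (x : 'rV[R]_(\dim {:T})) : T := \sum_i x 0 i *: e`_i.

Let gB x y : g (x - y) = g x - g y.
Proof.
rewrite /g -sumrB; apply: eq_bigr => i _.
by rewrite !mxE scalerBl.
Qed.

Let gZ c x : g (c *: x) = c *: g x.
Proof.
by rewrite /g scaler_sumr; apply: eq_bigr => i _; rewrite mxE scalerA.
Qed.

Let g_eq0 x : g x = 0 -> x = 0.
Proof.
move=> gx; apply/rowP => i; rewrite mxE.
have fe : free e by apply: basis_free (vbasisP _).
by rewrite -(coord_sum_free (fun i => x 0 i) i fe) -/(g x) gx linear0.
Qed.

Let g_surj v : exists x, g x = v.
Proof.
exists (\row_i coord e i v).
rewrite [RHS](coord_basis (vbasisP {:T}) (memvf v)).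
by apply: eq_bigr => i _; rewrite mxE.
Qed.

(** The triangle inequality along the basis gives the constant $\sum_i p(e_i)$ for the sup norm of
    the coordinates. Applied to differences, such a bound yields Lipschitz continuity. *)
Let seminorm_bounded (p : T -> R) :
  (forall u v, p (u + v) <= p u + p v) ->
  (forall c u, p (c *: u) = `|c| * p u) ->
  exists C, forall x, p (g x) <= C * `|x|.
Proof.
move=> pD pZ; exists (\sum_(i < \dim {:T}) p e`_i) => x.
(* Nonnegativity comes from $0=p(0)\le p(u)+p(-u)=2p(u)$. *)
have p0 u : 0 <= p u.
  have := pD u (-1 *: u); rewrite pZ normrN1 mul1r scaleN1r subrr.
  by have := pZ 0 0; rewrite scale0r normr0 mul0r => ->; lra.
have pS (r : seq 'I_(\dim {:T})) :
    p (\sum_(i <- r) x 0 i *: e`_i) <= \sum_(i <- r) `|x| * p e`_i.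
  elim: r => [|i r IH].
    by rewrite !big_nil -(scale0r 0) pZ normr0 mul0r.
  rewrite !big_cons; apply: le_trans (pD _ _) _; apply: lerD => //.
  rewrite pZ ler_wpM2r//.
  rewrite [`|x|]mx_normrE.
  exact: (le_bigmax _ (fun ij => `|x ij.1 ij.2|) (0, i)).
by apply: le_trans (pS _) _; rewrite -mulr_sumr mulrC.
Qed.

(** The continuous ratio [l / N] has a maximum on the compact unit sphere of the coordinate space;
    being invariant under positive scaling, it is maximal there among all nonzero vectors. The
    cross-multiplied conclusion also covers [u = 0]. *)
Lemma seminorm_ratio_max (N l : T -> R) :
  (forall u v, N (u + v) <= N u + N v) ->
  (forall c u, N (c *: u) = `|c| * N u) ->
  (forall u, u != 0 -> 0 < N u) ->
  scalar l -> (exists u : T, u != 0) ->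
  exists2 u0, u0 != 0 & forall u, l u * N u0 <= l u0 * N u.
Proof.
move=> ND NZ N0 ll [w w0].
have lD u v : l (u + v) = l u + l v by have := ll 1 u v; rewrite scale1r mul1r.
have l0 : l 0 = 0 by apply: (addrI (l 0)); rewrite -lD !addr0.
have lZ c u : l (c *: u) = c * l u by have := ll c u 0; rewrite !addr0 l0 addr0.
have lB u v : l (u - v) = l u - l v by rewrite -scaleN1r lD lZ mulN1r.
have Nl u v : `|N u - N v| <= N (u - v).
  rewrite ler_norml; apply/andP; split.
    have := ND u (-1 *: (u - v)); rewrite NZ normrN1 mul1r scaleN1r opprB.
    by rewrite addrC subrK; lra.
  by have := ND v (u - v); rewrite addrC subrK; lra.
have cN : continuous (N \o g).
  have [C HC] := seminorm_bounded ND NZ.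
  apply: (@lipschitz_continuous_rV _ _ C) => x y /=.
  by apply: le_trans (Nl _ _) _; rewrite -gB.
have cl : continuous (l \o g).
  have [||C HC] := @seminorm_bounded (fun u => `|l u|).
  - by move=> u v; rewrite lD ler_normD.
  - by move=> c u; rewrite lZ normrM.
  by apply: (@lipschitz_continuous_rV _ _ C) => x y /=; rewrite -lB -gB.
pose S := [set x : 'rV[R]_(\dim {:T}) | `|x| = 1].
have normalize x : x != 0 -> S (`|x|^-1 *: x).
  by move=> x0; rewrite /S/= normrZ normfV normr_id mulVf// normr_eq0.
have S_g0 x : S x -> g x != 0.
  move=> Sx; apply/eqP => /g_eq0 x0; move: Sx.
  by rewrite /S/= x0 normr0 => /esym/eqP; rewrite oner_eq0.
have gN0 x : g x != 0 -> x != 0.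
  by apply: contra_neq => ->; rewrite /g big1// => i _; rewrite mxE scale0r.
have S0 : S !=set0.
  have [x xw] := g_surj w; exists (`|x|^-1 *: x).
  by apply/normalize/gN0; rewrite xw.
have cS : compact S.
  apply: bounded_closed_compact.
    by exists 1; split => // M M1 x /= ->; exact: ltW.
  by apply: (closed_comp (f := fun x : 'rV[R]_(\dim {:T}) => `|x|)
       (D := [set 1 : R]));
     [move=> x _; exact: norm_continuous|exact: closed_eq].
have cF : {within S, continuous (fun x => l (g x) / N (g x))}.
  apply: continuous_in_subspaceT => x; rewrite inE => Sx.
  have cV : {for x, continuous (fun y => (N (g y))^-1)}.
    by apply: continuousV; [rewrite gt_eqF// N0// S_g0|exact: cN].
  exact: (continuousM (cl x) cV).
have [x0] := EVT_max_rV S0 cS cF; rewrite inE => Sx0 mx.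
exists (g x0); first exact: S_g0.
move=> u; have [->|u0] := eqVneq u 0.
  have -> : N 0 = 0 by have := NZ 0 0; rewrite scale0r normr0 mul0r.
  by rewrite l0 mul0r mulr0.
have [x xu] := g_surj u.
have xn0 : x != 0 by apply: gN0; rewrite xu.
have nx : 0 < `|x| by rewrite normr_gt0.
have := mx (`|x|^-1 *: x); rewrite inE => /(_ (normalize _ xn0)).
rewrite gZ lZ NZ normfV normr_id xu -mulf_div divff ?invr_neq0 ?gt_eqF// mul1r.
by rewrite ler_pdivrMr ?N0// mulrAC ler_pdivlMr// N0// S_g0.
Qed.

End RatioMax.

(** * Monotonicity and finite sums for real-valued integrals *)

Lemma ae_le_Rintegral d (T : measurableType d) (R : realType)
    (mu : {measure set T -> \bar R}) (D : set T) (g h : T -> R) :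
  measurable D -> mu.-integrable D (EFin \o g) ->
  mu.-integrable D (EFin \o h) ->
  {ae mu, forall x, D x -> g x <= h x} ->
  \int[mu]_(x in D) g x <= \int[mu]_(x in D) h x.
Proof.
move=> mD ig ih gh; rewrite -subr_ge0 -RintegralB//.
have ihg : mu.-integrable D (EFin \o (fun x => h x - g x)).
  by have := integrableB mD ih ig; apply: eq_integrable.
(* The absolute value changes the integrand only on a null set and makes it nonnegative
   everywhere. *)
rewrite (_ : Rintegral _ _ _ = \int[mu]_(x in D) `|h x - g x|).
  by apply: Rintegral_ge0.
rewrite /Rintegral; congr fine; apply: ae_eq_integral => //.
- exact: measurable_int ihg.
- apply/measurable_EFinP; apply: measurableT_comp => //.
  by apply/measurable_EFinP; exact: measurable_int ihg.
- by apply: filterS gh => x H Dx /=; rewrite ger0_norm// subr_ge0 H.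
Qed.

Lemma Rintegral_sum d (T : measurableType d) (R : realType)
    (mu : {measure set T -> \bar R}) (D : set T) (I : eqType) (r : seq I)
    (F : I -> T -> R) :
  measurable D -> (forall i, mu.-integrable D (EFin \o F i)) ->
  \int[mu]_(x in D) (\sum_(i <- r) F i x) =
  \sum_(i <- r) \int[mu]_(x in D) F i x.
Proof.
move=> mD iF; rewrite /Rintegral.
under eq_integral do rewrite -sumEFin.
rewrite integral_sum//; apply: EFin_inj.
rewrite fineK; last first.
  by apply/sum_fin_numP => i _ _; exact: (integrable_fin_num mD (iF i)).
rewrite -sumEFin; apply: eq_bigr => i _.
by rewrite fineK//; exact: (integrable_fin_num mD (iF i)).
Qed.

(** * Integrals of smooth functions against the weight [f] *)

Section WeightedIntegral.
Variables (R : realType) (a b : R) (f : R -> R).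
Local Notation mu := (@lebesgue_measure R).
Local Notation D := `[a, b]%classic.
Hypothesis hab : a <= b.
Hypothesis hfint : mu.-integrable D (EFin \o f).
Hypothesis hf0 : {ae mu, forall t, D t -> 0 <= f t}.
Hypothesis hfpos : 0 < \int[mu]_(t in D) f t.
Implicit Types g h : R -> R.

(** A continuous [h] on the compact interval attains its extrema, hence is bounded, and a bounded
    measurable factor preserves integrability of [f]. *)
Lemma smooth_on_weighted_integrable h : smooth_on D h ->
  mu.-integrable D (EFin \o (fun t => f t * h t)).
Proof.
move=> /smooth_on_continuous ch.
have mD : measurable D by exact: measurable_itv.
have mh : measurable_fun D h by exact: subspace_continuous_measurable_fun.
have bh : [bounded h x | x in D].
  have [x _ hx] := EVT_max hab ch; have [y _ hy] := EVT_min hab ch.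
  exists (`|h x| + `|h y|); split; first by rewrite num_real.
  move=> M HM t Dt; have := hx t Dt; have := hy t Dt => h1 h2.
  apply: le_trans (ltW HM); rewrite ler_norml; apply/andP; split.
    by have := ler_norm (- h y); have := normr_ge0 (h x); rewrite normrN; lra.
  by have := ler_norm (h x); have := normr_ge0 (h y); lra.
by have := @integrableMl _ _ _ mu D mD _ _ hfint mh bh; apply: eq_integrable.
Qed.

Lemma weighted_integralD g h : smooth_on D g -> smooth_on D h ->
  \int[mu]_(t in D) (f t * (g t + h t)) =
  \int[mu]_(t in D) (f t * g t) + \int[mu]_(t in D) (f t * h t).
Proof.
move=> sg sh; under eq_Rintegral do rewrite mulrDr.
by rewrite RintegralD//; exact: smooth_on_weighted_integrable.
Qed.

Lemma weighted_integralZ c h : smooth_on D h ->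
  \int[mu]_(t in D) (f t * (c * h t)) = c * \int[mu]_(t in D) (f t * h t).
Proof.
move=> sh; under eq_Rintegral do rewrite mulrCA.
by rewrite RintegralZl//; exact: smooth_on_weighted_integrable.
Qed.

Lemma le_weighted_integral g h : smooth_on D g -> smooth_on D h ->
  (forall t, D t -> g t <= h t) ->
  \int[mu]_(t in D) (f t * g t) <= \int[mu]_(t in D) (f t * h t).
Proof.
move=> sg sh gh; apply: ae_le_Rintegral => //.
- exact: smooth_on_weighted_integrable.
- exact: smooth_on_weighted_integrable.
- by apply: (filterS (F := almost_everywhere mu) _ hf0) => t ft Dt;
     rewrite ler_wpM2l ?ft ?gh.
Qed.

(** The minimum of [h] is attained, hence positive, and bounds the integral below by that minimum
    times the integral of [f]. The weight itself may vanish on a large set. *)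
Lemma weighted_integral_gt0 h : smooth_on D h -> (forall t, D t -> 0 < h t) ->
  0 < \int[mu]_(t in D) (f t * h t).
Proof.
move=> sh h0; have [y Dy hy] := EVT_min hab (smooth_on_continuous sh).
have /= H := @le_weighted_integral (fun=> h y) h (smooth_on_cst _ _) sh hy.
apply: lt_le_trans H; rewrite RintegralZr// mulr_gt0//.
exact: h0.
Qed.

End WeightedIntegral.

(** Stationarity at a minimum without derivatives: near [s = 0] the linear term would dominate and
    change sign. *)
Lemma linear_coef_eq0 (R : realFieldType) (L C : R) :
  (forall s, 0 <= s * L + s ^+ 2 * C) -> L = 0.
Proof.
move=> H; set K := `|C| + 1.
have K0 : 0 < K by rewrite ltr_pwDr.
have CK : C - K <= - 1 by have := ler_norm C; rewrite /K; lra.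
(* Since $C-K\le-1$, this choice of [s] makes the expression at most $-L^2/K^2$. *)
have := H (- L / K).
have -> : - L / K * L + (- L / K) ^+ 2 * C = L ^+ 2 * (C - K) / K ^+ 2.
  by field; rewrite gt_eqF.
rewrite pmulr_lge0 ?invr_gt0 ?exprn_gt0// => H1.
by apply/eqP; rewrite -sqrf_eq0 eq_le sqr_ge0 andbT; nra.
Qed.

(** * Linear forms and coordinatewise integration *)

Section VectorValuedTheory.
Variables (R : realType) (Z : vectType R).
Implicit Types (la : 'Hom(Z, R^o)) (z : Z).
Local Notation e := (vbasis {:Z}).
Local Notation mu := (@lebesgue_measure R).

Lemma vcoord_sum z : z = \sum_i vcoord i z *: e`_i.
Proof. exact: coord_basis (vbasisP _) (memvf z). Qed.

Lemma vcoordZ i c z : vcoord i (c *: z) = c * vcoord i z.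
Proof. by rewrite /vcoord linearZ. Qed.

Lemma lfun_vcoord la z : la z = \sum_i vcoord i z * la e`_i.
Proof.
rewrite [in LHS](vcoord_sum z) linear_sum; apply: eq_bigr => i _.
by rewrite linearZ.
Qed.

Lemma lfun_separates z1 z2 : (forall la, la z1 = la z2) -> z1 = z2.
Proof.
move=> H; rewrite (vcoord_sum z1) (vcoord_sum z2); apply: eq_bigr => i _.
by have := H (linfun (coord e i)); rewrite !lfunE /vcoord => ->.
Qed.

Lemma lfun_vintegrable (D : set R) (c : R -> Z) la : measurable D ->
  vintegrable D c -> mu.-integrable D (EFin \o (fun t => la (c t) : R)).
Proof.
move=> mD ic.
have H (i : 'I_(\dim {:Z})) :
    mu.-integrable D (fun t => (la e`_i)%:E * (vcoord i (c t))%:E)%E.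
  exact: integrableZl.
have := @integrable_sum _ _ _ mu D mD _ (index_enum _) predT _ (fun i _ => H i).
apply: eq_integrable => // t _ /=.
by rewrite lfun_vcoord -sumEFin; apply: eq_bigr => i _; rewrite mulrC EFinM.
Qed.

(** With [lfun_separates], this characterizes the coordinatewise integral through linear forms and
    reduces vector identities to scalar ones. *)
Lemma lfun_vintegral (D : set R) (c : R -> Z) la : measurable D ->
  vintegrable D c ->
  la (vintegral D c) = \int[mu]_(t in D) (la (c t) : R).
Proof.
move=> mD ic.
under eq_Rintegral do rewrite lfun_vcoord.
have H (i : 'I_(\dim {:Z})) :
    mu.-integrable D (EFin \o (fun t => vcoord i (c t) * la e`_i)).
  have := @integrableZr _ _ _ mu D mD (la e`_i) _ (ic i).
  by apply: eq_integrable.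
rewrite Rintegral_sum// /vintegral linear_sum; apply: eq_bigr => i _.
by rewrite linearZ RintegralZr//; exact: ic.
Qed.

End VectorValuedTheory.

(** * Smooth dependence of representatives and dual norms on [t] *)

Section SharpSmooth.
Variables (R : realType) (Z : vectType R) (D : set R) (A : R -> Z -> Z -> R).
Hypothesis hA : forall t, D t -> inner_product (A t).
Hypothesis hAsmooth : smooth_family D A.
Implicit Types (la nu : 'Hom(Z, R^o)).
Local Notation e := (vbasis {:Z}).

Let gram t : 'M[R]_(\dim {:Z}) := \matrix_(i, j) A t e`_i e`_j.

Let ip_suml t (I : finType) (F : I -> Z) v : D t ->
  A t (\sum_i F i) v = \sum_i A t (F i) v.
Proof.
move=> Dt; apply: (big_morph (fun u => A t u v)).
  by move=> x y; rewrite (ipDl (hA Dt)).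
by rewrite (ip0l (hA Dt)).
Qed.

Let mul_gram t (x : 'rV[R]_(\dim {:Z})) j : D t ->
  (x *m gram t) 0 j = A t (\sum_i x 0 i *: e`_i) e`_j.
Proof.
move=> Dt; rewrite ip_suml// mxE; apply: eq_bigr => i _.
by rewrite (ipZl (hA Dt)) mxE.
Qed.

(** A row in the kernel of the Gram matrix gives a vector orthogonal to the whole basis, hence to
    itself, so it is zero. *)
Let gram_unit t : D t -> gram t \in unitmx.
Proof.
move=> Dt; rewrite -row_free_unit -kermx_eq0; apply/rowV0P => x /sub_kermxP xG.
set z := \sum_i x 0 i *: e`_i.
have zr v : A t z v = 0.
  rewrite (vcoord_sum v) (ipC (hA Dt)) ip_suml// big1// => j _.
  by rewrite (ipZl (hA Dt)) (ipC (hA Dt)) -mul_gram// xG mxE mulr0.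
have z0 : z = 0.
  by apply/eqP; apply: contraT => /(ip_gt0 (hA Dt)); rewrite zr ltxx.
apply/rowP => i; rewrite mxE.
have fe : free e by apply: basis_free (vbasisP _).
by rewrite -(coord_sum_free (fun i => x 0 i) i fe) -/z z0 linear0.
Qed.

(** The coordinates of [sharp (A t) la] solve a linear system whose matrix is the Gram matrix, so
    the smooth inverse of that matrix gives them explicitly. *)
Lemma smooth_on_vcoord_sharp la i :
  smooth_on D (fun t => vcoord i (sharp (A t) la)).
Proof.
have H : smooth_on D
    (fun t => \sum_(j < \dim {:Z}) la e`_j * invmx (gram t) j i).
  apply: smooth_on_sum => j; apply: smooth_onM; first exact: smooth_on_cst.
  apply: smooth_on_invmx => // i' j'.
  by apply: smooth_on_ext (hAsmooth e`_i' e`_j') => t _; rewrite mxE.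
apply: smooth_on_ext H => t Dt.
pose x := \row_i vcoord i (sharp (A t) la).
have xG : x *m gram t = \row_j la e`_j.
  apply/rowP => j; rewrite mul_gram// mxE -(sharpE (hA Dt)).
  rewrite [in RHS](vcoord_sum (sharp (A t) la)); congr (A t _ _).
  by apply: eq_bigr => k _; rewrite mxE.
have -> : vcoord i (sharp (A t) la) = (x *m gram t *m invmx (gram t)) 0 i.
  by rewrite mulmxK ?gram_unit// mxE.
by rewrite xG mxE; apply: eq_bigr => j _; rewrite mxE.
Qed.

Lemma smooth_on_dual_form la nu : smooth_on D (fun t => dual_form (A t) la nu).
Proof.
have H : smooth_on D (fun t => \sum_i vcoord i (sharp (A t) nu) * la e`_i).
  apply: smooth_on_sum => i; apply: smooth_onM; last exact: smooth_on_cst.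
  exact: smooth_on_vcoord_sharp.
by apply: smooth_on_ext H => t _; rewrite -lfun_vcoord.
Qed.

Lemma dual_form_gt0 la t : D t -> la != 0 -> 0 < dual_form (A t) la la.
Proof.
move=> Dt la0; rewrite (dual_formE (hA Dt)) (ip_gt0 (hA Dt))//.
exact: (sharp_neq0 (hA Dt)).
Qed.

Lemma smooth_on_sqrt_dual_form la :
  smooth_on D (fun t => Num.sqrt (dual_form (A t) la la)).
Proof.
(* The square root is not smooth at 0, so the zero form, whose norm is constant, is set apart. *)
have [->|la0] := eqVneq la 0.
  apply: smooth_on_ext (smooth_on_cst D 0) => t _.
  by rewrite /dual_form zero_lfunE sqrtr0.
apply: smooth_on_sqrt; last exact: smooth_on_dual_form.
by move=> t Dt; exact: dual_form_gt0.
Qed.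

End SharpSmooth.

(** * The integrated dual norm and the optimal control *)

Section OptimalControl.
Variables (R : realType) (Z : vectType R) (a b : R).
Variables (A : R -> Z -> Z -> R) (f : R -> R) (q : Z).
Local Notation mu := (@lebesgue_measure R).
Local Notation D := `[a, b]%classic.
Hypothesis hab : a <= b.
Hypothesis hA : forall t, D t -> inner_product (A t).
Hypothesis hAsmooth : smooth_family D A.
Hypothesis hfint : mu.-integrable D (EFin \o f).
Hypothesis hf0 : {ae mu, forall t, D t -> 0 <= f t}.
Hypothesis hfpos : 0 < \int[mu]_(t in D) f t.
Implicit Types (la nu : 'Hom(Z, R^o)).

(** The denominator in [kconst], called [N] in the overview; the next lemmas show that it is a norm
    on the dual. *)
Definition dual_length la : R :=
  \int[mu]_(t in D) (f t * Num.sqrt (dual_form (A t) la la)).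

Let smooth_norm la : smooth_on D (fun t => form_norm (A t) (sharp (A t) la)).
Proof.
apply: smooth_on_ext (smooth_on_sqrt_dual_form hA hAsmooth la) => t Dt.
exact: (sqrt_dual_form (hA Dt)).
Qed.

Lemma dual_lengthE la : dual_length la =
  \int[mu]_(t in D) (f t * form_norm (A t) (sharp (A t) la)).
Proof.
apply: eq_Rintegral => t; rewrite inE => Dt.
by rewrite (sqrt_dual_form (hA Dt)).
Qed.

Lemma dual_length_gt0 la : la != 0 -> 0 < dual_length la.
Proof.
move=> la0; apply: weighted_integral_gt0 => //.
  exact: smooth_on_sqrt_dual_form.
by move=> t Dt; rewrite sqrtr_gt0; exact: (dual_form_gt0 hA).
Qed.

Lemma dual_lengthZ c la : dual_length (c *: la) = `|c| * dual_length la.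
Proof.
rewrite !dual_lengthE -weighted_integralZ//; apply: eq_Rintegral => t.
by rewrite inE => Dt; rewrite (sharpZ (hA Dt)) (form_normZ (hA Dt)).
Qed.

Lemma dual_lengthD la nu :
  dual_length (la + nu) <= dual_length la + dual_length nu.
Proof.
rewrite !dual_lengthE -weighted_integralD//; apply: le_weighted_integral => //.
  exact: smooth_onD.
by move=> t Dt; rewrite (sharpD (hA Dt)); exact: (form_normD (hA Dt)).
Qed.

(** Denominators are positive and can be cleared. For [Z = 0] both sides hold: the supremum is -oo
    and the condition is vacuous. *)
Lemma kconst_leP (k : R) : (kconst D q f A <= k%:E)%E <->
  forall la, la != 0 -> `|la q| <= k * dual_length la.
Proof.
split=> [H la la0|H].
  rewrite -ler_pdivrMr ?dual_length_gt0// -lee_fin; apply: le_trans H.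
  by apply: ereal_sup_ubound; exists la.
apply: ge_ereal_sup => _ [la la0 <-].
by rewrite lee_fin ler_pdivrMr ?H// dual_length_gt0.
Qed.

Lemma control_kconst_le (k : R) (c : R -> Z) : control D q f A k c ->
  (kconst D q f A <= k%:E)%E.
Proof.
move=> [mc ic iq cb]; apply/kconst_leP => la la0.
have mD : measurable D by exact: measurable_itv.
rewrite -iq lfun_vintegral//.
have il := lfun_vintegrable la mD ic.
apply: le_trans (@le_normr_Rintegral _ _ _ mu _ _ mD il) _.
rewrite dual_lengthE -weighted_integralZ//; apply: ae_le_Rintegral => //.
- by exact: (integrable_norm il).
- apply: smooth_on_weighted_integrable => //.
  by apply: smooth_onM => //; exact: smooth_on_cst.
- apply: (filterS (F := almost_everywhere mu) _ cb) => t /[swap] Dt /(_ Dt) ct.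
  (* Writing [la (c t)] as an inner product with the representative lets Cauchy-Schwarz apply
     pointwise. *)
  rewrite -(sharpE (hA Dt)); apply: le_trans (ip_norm_le (hA Dt) _ _) _.
  have n0 : 0 <= form_norm (A t) (sharp (A t) la) by exact: sqrtr_ge0.
  by rewrite mulrCA mulrA [leRHS]mulrC ler_wpM2l.
Qed.

Lemma vsmooth_on_vintegrable (d : R -> Z) : vsmooth_on D d ->
  vintegrable D (fun t => f t *: d t).
Proof.
move=> sd i; have := smooth_on_weighted_integrable hab hfint (sd i).
by apply: eq_integrable => // t _ /=; rewrite vcoordZ.
Qed.

Lemma smooth_control (k : R) (d : R -> Z) : vsmooth_on D d ->
  (forall t, D t -> form_norm (A t) (d t) <= k) ->
  vintegral D (fun t => f t *: d t) = q ->
  control D q f A k (fun t => f t *: d t).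
Proof.
move=> sd dk iq.
have ifd := vsmooth_on_vintegrable sd.
split=> //.
  by move=> i; apply/measurable_EFinP; exact: (measurable_int _ (ifd i)).
apply: (filterS (F := almost_everywhere mu) _ hf0) => t /[swap] Dt /(_ Dt) ft.
by rewrite (form_normZ (hA Dt)) ger0_norm// mulrC ler_wpM2r// dk.
Qed.

(** One pair [k0], [d] serves every admissible bound. The sign condition on [k] in the last clause
    matters when [Z = 0]: there [kconst] is -oo while [k0] is 0. *)
Lemma optimal_control : exists k0 d,
  [/\ 0 <= k0, vsmooth_on D d,
      (forall t, D t -> form_norm (A t) (d t) <= k0),
      vintegral D (fun t => f t *: d t) = q
    & forall k : R, 0 <= k -> (kconst D q f A <= k%:E)%E -> k0 <= k].
Proof.
have mD : measurable D by exact: measurable_itv.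
have [nz|/forallNP triv] := pselect (exists la : 'Hom(Z, R^o), la != 0);
    last first.
  have Z0 z : z = 0 :> Z.
    apply: lfun_separates => la; rewrite linear0.
    by have /negP/negPn/eqP -> := triv la; rewrite zero_lfunE.
  exists 0, (fun=> 0); split=> //; last by rewrite [LHS]Z0 [RHS]Z0.
    by move=> i; exact: smooth_on_cst.
  by move=> t Dt; rewrite /form_norm (ip0l (hA Dt)) sqrtr0.
have [|la0 la0n la0max] := seminorm_ratio_max (l := fun la => la q)
  dual_lengthD dual_lengthZ dual_length_gt0 _ nz.
  by move=> c la nu; rewrite add_lfunE scale_lfunE.
have N0 := dual_length_gt0 la0n.
pose k0 := la0 q / dual_length la0.
have k0N : k0 * dual_length la0 = la0 q by rewrite mulfVK// gt_eqF.
have k0_ge0 : 0 <= k0.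
  rewrite divr_ge0 ?(ltW N0)//.
  (* Maximality against the opposite form gives $-\lambda_0(q)\le\lambda_0(q)$. *)
  have := la0max (-1 *: la0); rewrite dual_lengthZ normrN1 mul1r.
  rewrite scale_lfunE ler_pM2r// scaleN1r; lra.
have k0max la : la q <= k0 * dual_length la.
  by rewrite /k0 mulrAC ler_pdivlMr// la0max.
pose n0 t := form_norm (A t) (sharp (A t) la0).
have n0_gt0 t : D t -> 0 < n0 t.
  by move=> Dt; apply/(form_norm_gt0 (hA Dt))/(sharp_neq0 (hA Dt)).
have sn0 : smooth_on D n0 by exact: smooth_norm.
have sn0V : smooth_on D (fun t => (n0 t)^-1).
  by apply: smooth_onV => // t /n0_gt0 n0t; rewrite gt_eqF.
pose d t := (k0 / n0 t) *: sharp (A t) la0.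
have sk : smooth_on D (fun t => k0 / n0 t).
  by apply: smooth_onM => //; exact: smooth_on_cst.
have sd : vsmooth_on D d.
  move=> i; have := smooth_onM sk (smooth_on_vcoord_sharp hA hAsmooth la0 i).
  by apply: smooth_on_ext => t _; rewrite vcoordZ.
have ifd := vsmooth_on_vintegrable sd.
exists k0, d; split=> //.
- move=> t Dt; rewrite (form_normZ (hA Dt)) ger0_norm ?divfK//.
    by rewrite gt_eqF// n0_gt0.
  by rewrite divr_ge0// ltW// n0_gt0.
- apply: lfun_separates => nu; rewrite lfun_vintegral//.
  (* [P] and [Q] are the coefficients of [s] and [s ^+ 2] in the tangent bound for the norm of
     [la0 + s *: nu]. *)
  pose P t := A t (sharp (A t) la0) (sharp (A t) nu) / n0 t.
  pose Q t := A t (sharp (A t) nu) (sharp (A t) nu) / (2 * n0 t).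
  have sP : smooth_on D P.
    apply: smooth_onM => //.
    apply: smooth_on_ext (smooth_on_dual_form hA hAsmooth la0 nu) => t Dt.
    by rewrite (dual_formE (hA Dt)).
  have sQ : smooth_on D Q.
    have := smooth_onM (smooth_on_dual_form hA hAsmooth nu nu)
      (smooth_onM (smooth_on_cst D 2^-1) sn0V).
    apply: smooth_on_ext => t Dt.
    by rewrite (dual_formE (hA Dt)) /Q invfM.
  have -> : \int[mu]_(t in D) (nu (f t *: d t) : R) =
      k0 * \int[mu]_(t in D) (f t * P t).
    rewrite -weighted_integralZ//; apply: eq_Rintegral => t; rewrite inE => Dt.
    rewrite !linearZ/= -(sharpE (hA Dt)) (ipC (hA Dt)) /P.
    by rewrite /GRing.scale/=; ring.
  apply/eqP; rewrite -subr_eq0; apply/eqP.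
  (* The quadratic in [s] bounds $k_0N(\lambda_0+s\nu)-(\lambda_0+s\nu)(q)\ge0$ from above; its
     constant term cancels by [k0N]. *)
  apply: (@linear_coef_eq0 _ _ (k0 * \int[mu]_(t in D) (f t * Q t))) => s.
  have sPs : smooth_on D (fun t => s * P t).
    by apply: smooth_onM => //; exact: smooth_on_cst.
  have sQs : smooth_on D (fun t => s ^+ 2 * Q t).
    by apply: smooth_onM => //; exact: smooth_on_cst.
  have snP : smooth_on D (fun t => n0 t + s * P t) by exact: smooth_onD.
  have Nle : dual_length (la0 + s *: nu) <= dual_length la0
      + s * \int[mu]_(t in D) (f t * P t)
      + s ^+ 2 * \int[mu]_(t in D) (f t * Q t).
    rewrite !dual_lengthE -!weighted_integralZ// -!weighted_integralD//.
    apply: le_weighted_integral => //; first exact: smooth_onD.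
    move=> t Dt; rewrite (sharpD (hA Dt)) (sharpZ (hA Dt)).
    exact/(form_norm_tangent (hA Dt))/(sharp_neq0 (hA Dt)).
  have := k0max (la0 + s *: nu); rewrite add_lfunE scale_lfunE /GRing.scale/=.
  have := ler_wpM2l k0_ge0 Nle; rewrite !mulrDr k0N; nra.
- move=> k _ /kconst_leP /(_ _ la0n) H.
  rewrite /k0 ler_pdivrMr//; exact: le_trans (ler_norm _) H.
Qed.

End OptimalControl.

Theorem lemma5p3 (R : realType) (Z : vectType R) (a b : R) (hab : a <= b)
    (A : R -> Z -> Z -> R) (f : R -> R) (q : Z)
    (hA : forall t, `[a, b]%classic t -> inner_product (A t))
    (hAsmooth : smooth_family `[a, b]%classic A)
    (hfint : (@lebesgue_measure R).-integrable `[a, b]%classic (EFin \o f))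
    (hf0 : {ae @lebesgue_measure R,
              forall t, `[a, b]%classic t -> 0 <= f t})
    (hfpos : 0 < \int[@lebesgue_measure R]_(t in `[a, b]%classic) f t) :
  [/\ (forall k : R, 0 <= k ->
         (exists c : R -> Z, control `[a, b]%classic q f A k c)
         <-> (kconst `[a, b]%classic q f A <= k%:E)%E),
      (forall k : R, 0 <= k -> (kconst `[a, b]%classic q f A <= k%:E)%E ->
         exists d : R -> Z,
           [/\ vsmooth_on `[a, b]%classic d,
               (forall t, `[a, b]%classic t -> form_norm (A t) (d t) <= k)
             & control `[a, b]%classic q f A k (fun t => f t *: d t)])
    & admissible_bounds `[a, b]%classic q f A
        (inf (admissible_bounds `[a, b]%classic q f A))].
Proof.
have [k0 [d [k0_ge0 sd dk0 iq k0min]]] :=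
  optimal_control q hab hA hAsmooth hfint hf0 hfpos.
(* The bound on [d] only relaxes as [k] grows, so the same [d] is reused for all larger [k]. *)
have control_d k : k0 <= k ->
    control `[a, b]%classic q f A k (fun t => f t *: d t).
  move=> k0k; apply: smooth_control => // t Dt.
  exact: le_trans (dk0 t Dt) k0k.
split.
- move=> k k_ge0; split=> [[c]|/(k0min _ k_ge0) k0k].
    exact: control_kconst_le.
  by exists (fun t => f t *: d t); exact: control_d.
- move=> k k_ge0 /(k0min _ k_ge0) k0k; exists d; split=> //.
    by move=> t Dt; exact: le_trans (dk0 t Dt) k0k.
  exact: control_d.
- have k0S : admissible_bounds `[a, b]%classic q f A k0.
    by split=> //; exists (fun t => f t *: d t); exact: control_d.
  have lbk0 : lbound (admissible_bounds `[a, b]%classic q f A) k0.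
    move=> k [k_ge0 [c cc]]; apply: k0min => //.
    exact: (control_kconst_le hab hA hAsmooth hfint hf0 hfpos cc).
  (* As [k0] is both a member and a lower bound, the set is nonempty and bounded below, so [inf] is
     its true infimum and equals [k0]. *)
  suff -> : inf (admissible_bounds `[a, b]%classic q f A) = k0 by [].
  apply/eqP; rewrite eq_le; apply/andP; split.
    by apply: ge_inf => //; exists k0.
  by apply: lb_le_inf => //; exists k0.
Qed.
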